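(* Let $G$ be a locally compact group, $K$ a compact subgroup with normalized Haar measure $dk$, $\delta>0$, and $\mu$ a continuous unitary character of $G$. Let $f,g\in\mathcal{C}(G)$ with $f$ $K$-central satisfy $$\Big|\int_K f(xkyk^{-1})\,dk+\mu(y)\int_K f(xky^{-1}k^{-1})\,dk-2f(x)g(y)\Big|\le\delta\quad\text{for all }x,y\in G.$$ Then one of the following holds: (1) $f$ and $g$ are bounded; (2) $f$ is unbounded and $g$ satisfies $\int_K g(xkyk^{-1})\,dk+\mu(y)\int_K g(xky^{-1}k^{-1})\,dk=2g(x)g(y)$ for all $x,y\in G$; (3) $g$ is unbounded and $(f,g)$ satisfies $\int_K f(xkyk^{-1})\,dk+\mu(y)\int_K f(xky^{-1}k^{-1})\,dk=2f(x)g(y)$ for all $x,y\in G$; moreover, in this case, if $f\neq0$ and $C_Kf\neq0$, then $g$ satisfies the equation in (2).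
   Context: A unitary character is a continuous homomorphism $\mu:G\to\{z\in\mathbb{C}:|z|=1\}$. $(C_Kf)(x)=\int_Kf(kxk^{-1})\,dk$. A function $f$ is $K$-central if $f(kx)=f(xk)$ for all $k\in K,x\in G$. *)

(* Defs.v *)
From HB Require Import structures.
From mathcomp Require Import all_boot all_order all_algebra.
From mathcomp Require Import all_classical all_reals all_analysis.
From mathcomp Require Import complex.
Set Implicit Arguments. Unset Strict Implicit. Unset Printing Implicit Defensive.
Import Order.TTheory GRing.Theory Num.Theory.
Import numFieldNormedType.Exports.
Local Open Scope ring_scope.
Local Open Scope classical_set_scope.

Definition is_group {G : Type} (mul : G -> G -> G) (inv : G -> G) (e : G) :=
  [/\ forall x y z, mul x (mul y z) = mul (mul x y) z,
      forall x, mul e x = x, forall x, mul x e = x,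
      forall x, mul (inv x) x = e & forall x, mul x (inv x) = e].

Definition locally_compact_group {G : ptopologicalType}
  (mul : G -> G -> G) (inv : G -> G) (e : G) :=
  [/\ is_group mul inv e,
      continuous (fun p : G * G => mul p.1 p.2),
      continuous inv,
      hausdorff_space G &
      locally_compact [set: G]].

Definition compact_subgroup {G : ptopologicalType}
  (mul : G -> G -> G) (inv : G -> G) (e : G) (K : set G) :=
  [/\ K e, (forall x y, K x -> K y -> K (mul x y)),
      (forall x, K x -> K (inv x)) & compact K].

Notation borelG G := (g_sigma_algebraType (@open G)).

(** m is the normalized Haar measure of the compact subgroup K, viewed as a
    Borel measure on G carried by K: a left K-invariant probability measure
    on K.  (On a compact group such a measure integrates continuous functions
    exactly as the Haar measure does.) *)
Definition normalized_haar {G : ptopologicalType} {R : realType}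
  (mul : G -> G -> G) (K : set G) (m : {measure set (borelG G) -> \bar R}) :=
  [/\ m K = 1%E, m (~` K) = 0%E &
      forall (k : G) (A : set (borelG G)), K k -> measurable A ->
        m [set mul k a | a in A] = m A].

Definition Kint {G : ptopologicalType} {R : realType}
  (m : {measure set (borelG G) -> \bar R}) (K : set G) (h : G -> R[i]) : R[i] :=
  Complex (Rintegral m (K : set (borelG G)) (fun k => complex.Re (h k)))
          (Rintegral m (K : set (borelG G)) (fun k => complex.Im (h k))).

Definition ccontinuous {G : ptopologicalType} {R : realType} (h : G -> R[i]) :=
  continuous (fun x => complex.Re (h x)) /\ continuous (fun x => complex.Im (h x)).

Definition unitary_character {G : ptopologicalType} {R : realType}
  (mul : G -> G -> G) (mu : G -> R[i]) :=
  [/\ forall x y, mu (mul x y) = mu x * mu y,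
      forall x, `|mu x| = 1 & ccontinuous mu].

Definition cbounded {G : Type} {R : realType} (h : G -> R[i]) :=
  exists M : R, forall x, `|h x| <= (M%:C)%C.

Definition K_central {G : Type} {R : realType} (mul : G -> G -> G) (K : set G)
  (f : G -> R[i]) := forall k x, K k -> f (mul k x) = f (mul x k).

Definition CK {G : ptopologicalType} {R : realType} (mul : G -> G -> G)
  (inv : G -> G) (m : {measure set (borelG G) -> \bar R}) (K : set G)
  (f : G -> R[i]) : G -> R[i] :=
  fun x => Kint m K (fun k => f (mul k (mul x (inv k)))).

Definition dal_lhs {G : ptopologicalType} {R : realType} (mul : G -> G -> G)
  (inv : G -> G) (m : {measure set (borelG G) -> \bar R}) (K : set G)
  (mu : G -> R[i]) (f : G -> R[i]) (x y : G) : R[i] :=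
  Kint m K (fun k => f (mul x (mul k (mul y (inv k)))))
  + mu y * Kint m K (fun k => f (mul x (mul k (mul (inv y) (inv k))))).

Definition dal_eq {G : ptopologicalType} {R : realType} (mul : G -> G -> G)
  (inv : G -> G) (m : {measure set (borelG G) -> \bar R}) (K : set G)
  (mu : G -> R[i]) (f g : G -> R[i]) :=
  forall x y : G, dal_lhs mul inv m K mu f x y = 2 * f x * g y.

(* Main.v *)
Require Import Defs.
From HB Require Import structures.
From mathcomp Require Import all_boot all_order all_algebra.
From mathcomp Require Import all_classical all_reals all_analysis.
From mathcomp Require Import complex.
From mathcomp Require Import ring measurable_realfun.
Set Implicit Arguments. Unset Strict Implicit. Unset Printing Implicit Defensive.
Import Order.TTheory GRing.Theory Num.Theory.
Import numFieldNormedType.Exports.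
Local Open Scope ring_scope.
Local Open Scope classical_set_scope.

(** Write [E_x F z] for the integral of [F (z k x k^-1)] over [K], and work
    modulo bounded functions.  If [f] is bounded and [g] is not, then
    [f x * g y] is bounded, so [f = 0].  If [f] is unbounded, the hypothesis
    reads [(E_y + mu y E_{y^-1}) f = 2 g y f].  The operators [E_x] span an
    algebra with involution [E_x^* = mu x E_{x^-1}] (the measures underlying
    [E_x] are closed under convolution), and [a + a^*] acts on [f] as a scalar
    for every [a] in it.  For [H = E_y + mu y E_{y^-1}] and [a = E_x], applying
    this to [E_x E_y] and [E_x E_{y^-1}] gives [H a f = 2 g y a f + c f], where
    [c = 0] is exactly the desired equation for [g] at [(x, y)].  The element
    [a H a^*] is self-adjoint, so [a H a^* f] is a multiple of [f]; expanding it
    shows that [c a f] is a multiple of [f].  If [c] were nonzero, [a f] would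
    be a multiple of [f], whence [H a f = 2 g y a f] and [c f = 0], i.e. [f]
    would be bounded. *)

(** * Continuity of pairings and of partial maps *)

Lemma continuous_pair (X Y Z : topologicalType) (a : X -> Y) (b : X -> Z) :
  continuous a -> continuous b -> continuous (fun x => (a x, b x)).
Proof. by move=> ca cb x; apply: cvg_pair; [exact: ca|exact: cb]. Qed.

Lemma continuous_uncurry_l (T U V : topologicalType) (h : T -> U -> V) t :
  continuous (fun p : T * U => h p.1 p.2) -> continuous (h t).
Proof.
move=> ch x; apply: (@continuous_comp _ _ _ (fun y => (t, y))
  (fun p : T * U => h p.1 p.2)); last exact: ch.
by apply: continuous_pair => p; [exact: cvg_cst|exact: cvg_id].
Qed.

Lemma continuous_uncurry_swap (T U V : topologicalType) (h : T -> U -> V) :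
  continuous (fun p : T * U => h p.1 p.2) ->
  continuous (fun p : U * T => h p.2 p.1).
Proof.
move=> ch x; apply: (@continuous_comp _ _ _ (fun p : U * T => (p.2, p.1))
  (fun p : T * U => h p.1 p.2)); last exact: ch.
by apply: continuous_pair => p; [exact: cvg_snd|exact: cvg_fst].
Qed.

(** * Integration of continuous real functions over a compact set of mass one *)

Section compact_integral.
Context {R : realType} {G : ptopologicalType}.
Variable K : set G.
Hypotheses (hG : hausdorff_space G) (cK : compact K).
Variable m : {measure set (borelG G) -> \bar R}.
Hypothesis mK1 : m K = 1%E.

Lemma measurable_open_borelG (A : set G) :
  open A -> measurable (A : set (borelG G)).
Proof. by move=> oA; apply: sub_sigma_algebra. Qed.

Lemma measurable_compact_borelG : measurable (K : set (borelG G)).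
Proof.
rewrite -[K]setCK; apply: measurableC; apply: measurable_open_borelG.
by apply: closed_openC; exact: compact_closed.
Qed.

Lemma continuous_measurable_borelG (S : set G) (h : G -> R) :
  continuous h -> measurable (S : set (borelG G)) ->
  measurable_fun (S : set (borelG G)) (h : borelG G -> R).
Proof.
move=> /continuousP ch mS.
apply: (measurability _ (RGenOpens.measurableE R)) => /= _ [_ [a [b ->] <-]].
by apply: measurableI => //; apply: measurable_open_borelG; exact/ch/interval_open.
Qed.

Section subset.
Variable S : set G.
Hypotheses (mS : measurable (S : set (borelG G))) (SK : S `<=` K).

Lemma measure_sub_compact_le1 : (m S <= 1)%E.
Proof.
by rewrite -mK1; apply: le_measure => //; rewrite inE//; exact: measurable_compact_borelG.
Qed.

Lemma continuous_integrable (h : G -> R) :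
  continuous h -> m.-integrable (S : set (borelG G)) (EFin \o h).
Proof.
move=> ch; apply: measurable_bounded_integrable => //.
- by apply: le_lt_trans measure_sub_compact_le1 _; rewrite ltry.
- exact: continuous_measurable_borelG.
have /compact_bounded : compact (h @` K).
  by apply: continuous_compact => //; exact: continuous_subspaceT.
case=> M [Mr HM]; exists M; split=> // r /HM hr x Sx.
by apply: hr; exists x => //; exact: SK.
Qed.

Lemma le_Rintegral_bound (h : G -> R) (c : R) : continuous h -> 0 <= c ->
  (forall x, S x -> `|h x| <= c) ->
  `|Rintegral m S h| <= c * fine (m S).
Proof.
move=> ch c0 hc; rewrite -Rintegral_cst//.
have ih := continuous_integrable ch.
apply: (le_trans (le_normr_Rintegral mS ih)).
apply: le_Rintegral => //.
- apply: (@continuous_integrable (fun x => `|h x|)).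
  by move=> x; apply: cvg_norm; exact: ch.
- by apply: (@continuous_integrable (fun=> c)) => x; exact: cvg_cst.
Qed.

End subset.

(** Compactness of [K] upgrades joint continuity to continuity in [t] uniform over [k] in [K]. Both
    parametric continuity and the Fubini argument rest on this. *)
Lemma tube (T : topologicalType) (h : T -> G -> R) (t0 : T) (e : R) :
  continuous (fun p : T * G => h p.1 p.2) -> 0 < e ->
  \forall t \near t0, forall k, K k -> `|h t k - h t0 k| < e.
Proof.
move=> ch e0; apply: (iffLR (compact_near_coveringP K)) => // x Kx.
have e2 : 0 < e / 2 by rewrite divr_gt0.
have c1 := continuous_uncurry_swap ch.
have c2 : continuous (fun p : G * T => h t0 p.1).
  move=> p; apply: (@continuous_comp _ _ _ fst (h t0)); first exact: cvg_fst.
  exact: (@continuous_uncurry_l _ _ _ h).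
have /cvgrPdist_lt /(_ _ e2) {}c1 := c1 (x, t0).
have /cvgrPdist_lt /(_ _ e2) {}c2 := c2 (x, t0).
apply: filterS2 c1 c2 => p /= A B.
(* Near [(x, t0)] both terms are compared with [h t0 x], at a cost of [e / 2] each. *)
rewrite (_ : _ - _ = (h t0 x - h t0 p.1) - (h t0 x - h p.2 p.1)); last by ring.
by apply: (le_lt_trans (ler_normB _ _)); rewrite [ltRHS]splitr ltrD.
Qed.

Section subset.
Variable S : set G.
Hypotheses (mS : measurable (S : set (borelG G))) (SK : S `<=` K).

Lemma Rintegral_dist_le (h1 h2 : G -> R) (c : R) :
  continuous h1 -> continuous h2 -> 0 <= c ->
  (forall x, S x -> `|h1 x - h2 x| <= c) ->
  `|Rintegral m S h1 - Rintegral m S h2| <= c * fine (m S).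
Proof.
move=> c1 c2 c0 hc; rewrite -RintegralB//; try exact: continuous_integrable.
apply: le_Rintegral_bound => // x.
by apply: cvgB; [exact: c1|exact: c2].
Qed.

Lemma fine_measure_sub_le1 : 0 <= fine (m S) <= 1.
Proof.
have := measure_sub_compact_le1 mS SK; rewrite fine_ge0//=.
by case: (m S) => [r| |]//=; rewrite ?lee_fin// => _; exact: ler01.
Qed.

Lemma continuous_Rintegral_param (T : topologicalType) (h : T -> G -> R) :
  continuous (fun p : T * G => h p.1 p.2) ->
  continuous (fun t => Rintegral m S (h t)).
Proof.
move=> ch t0.
have cs t : continuous (h t) by exact: (@continuous_uncurry_l _ _ _ h).
apply/cvgrPdist_le => e e0; near=> t.
have ht : forall k, K k -> `|h t k - h t0 k| < e by near: t; exact: tube.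
have /andP[mS0 mS1] := fine_measure_sub_le1.
apply: (@le_trans _ _ (e * fine (m S))); last by rewrite ler_piMr// ltW.
apply: Rintegral_dist_le => //; first exact: ltW.
by move=> x Sx; rewrite distrC ltW// ht//; exact: SK.
Unshelve. all: by end_near. Qed.

End subset.

(** * Exchange of two integrals over the compact set *)

Section fubini.
Variable h : G -> G -> R.
Hypothesis ch : continuous (fun p : G * G => h p.1 p.2).

Let ch1 k : continuous (h k) := @continuous_uncurry_l _ _ _ h k ch.
Let ch2 l : continuous (h^~ l) :=
  @continuous_uncurry_l _ _ _ (fun l k => h k l) l (continuous_uncurry_swap ch).
Let KK : K `<=` K := @subset_refl _ K.
Let mK := measurable_compact_borelG.

(** Fubini error on [K * S]. It is subadditive in [S], so local estimates can be summed over a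
    partition of [K]. *)
Let defect (S : set G) :=
  `|Rintegral m K (fun k => Rintegral m S (h k))
    - Rintegral m S (fun l => Rintegral m K (h^~ l))|.

(** If [h] hardly varies in its second variable over [S], freezing that variable at [l0] puts both
    iterated integrals within [e * fine (m S)] of the same number; hence the factor 2. *)
Let defect_small (S : set G) (l0 : G) (e : R) :
  measurable (S : set (borelG G)) -> S `<=` K -> 0 <= e ->
  (forall l k, S l -> K k -> `|h k l - h k l0| <= e) ->
  defect S <= 2 * e * fine (m S).
Proof.
move=> mS SK e0 hS; have /andP[mS0 mS1] := fine_measure_sub_le1 mS SK.
set c := Rintegral m K (h^~ l0).
have A : `|Rintegral m K (fun k => Rintegral m S (h k)) - c * fine (m S)|
    <= e * fine (m S).
  rewrite /c -RintegralZr//; last exact: continuous_integrable.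
  rewrite -[leRHS]mulr1 -[1](_ : fine (m K) = 1); last by rewrite mK1.
  apply: Rintegral_dist_le => //.
  - exact: continuous_Rintegral_param.
  - by move=> x; apply: cvgMl; exact: ch2.
  - by rewrite mulr_ge0.
  - move=> k Kk; rewrite -Rintegral_cst//; apply: Rintegral_dist_le => //.
      by move=> x; exact: cvg_cst.
    by move=> l Sl; exact: hS.
have B : `|Rintegral m S (fun l => Rintegral m K (h^~ l)) - c * fine (m S)|
    <= e * fine (m S).
  rewrite -Rintegral_cst//; apply: Rintegral_dist_le => //.
  - by apply: continuous_Rintegral_param => //; exact: continuous_uncurry_swap.
  - by move=> x; exact: cvg_cst.
  - move=> l Sl; rewrite -[leRHS]mulr1 -[1](_ : fine (m K) = 1); last by rewrite mK1.
    by apply: Rintegral_dist_le => // k Kk; exact: hS.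
rewrite distrC in B.
apply: (le_trans (ler_distD (c * fine (m S)) _ _)).
by apply: (le_trans (lerD A B)); rewrite -mulrDl mulr_natl mulr2n.
Qed.

(** Induction on the list of covering sets: [S] is cut into its part inside [U i], where
    [defect_small] applies, and the rest, covered by the remaining sets. The bound is additive
    because [m] is. *)
Let defect_cover (U : G -> set G) (e : R) (s : seq G) (S : set G) :
  0 <= e -> (forall i, open (U i)) ->
  (forall i l k, U i l -> K k -> `|h k l - h k i| <= e) ->
  measurable (S : set (borelG G)) -> S `<=` K ->
  (forall l, S l -> exists2 i, i \in s & U i l) ->
  defect S <= 2 * e * fine (m S).
Proof.
move=> e0 oU hU; elim: s S => [|i s IH] S mS SK hS.
  (* An empty cover forces [S] to be empty, so any base point will do. *)
  by apply: (@defect_small S point) => // l k /hS[].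
have mU : measurable (U i : set (borelG G)) by exact: measurable_open_borelG.
set S1 := S `&` U i; set S2 := S `\` U i.
have mS1 : measurable (S1 : set (borelG G)) by exact: measurableI.
have mS2 : measurable (S2 : set (borelG G)) by exact: measurableD.
have S1K : S1 `<=` K by move=> x [/SK].
have S2K : S2 `<=` K by move=> x [/SK].
have SU : S = S1 `|` S2 by rewrite /S1 /S2 setUIDK.
have S12 : [disjoint S1 & S2].
  by apply/disj_setPS => x [[_ ?] [_]].
have RU (g : G -> R) : continuous g ->
    Rintegral m S g = Rintegral m S1 g + Rintegral m S2 g.
  by move=> cg; rewrite {1}SU Rintegral_setU// -SU; exact: continuous_integrable.
have d1 : defect S1 <= 2 * e * fine (m S1).
  apply: (@defect_small S1 i) => // l k [_ Ul] Kk; exact: hU.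
have d2 : defect S2 <= 2 * e * fine (m S2).
  apply: IH => // l [Sl nU]; have [j] := hS l Sl; rewrite inE => /predU1P[->//|].
  by exists j.
have mE : fine (m S) = fine (m S1) + fine (m S2).
  have := RU (fun=> 1) (fun x => @cvg_cst R 1 G (nbhs x) _).
  by rewrite !Rintegral_cst// !mul1r; apply.
have dE : defect S <= defect S1 + defect S2.
  rewrite /defect RU; last first.
    by apply: continuous_Rintegral_param => //; exact: continuous_uncurry_swap.
  under eq_Rintegral do rewrite RU//.
  rewrite RintegralD//; try by apply: continuous_integrable => //; exact: continuous_Rintegral_param.
  by rewrite opprD addrACA ler_normD.
by rewrite mE mulrDr (le_trans dE)// lerD.
Qed.

(* The Borel sigma-algebra of G * G may exceed the product of the Borel
   sigma-algebras, so Fubini is proved by uniform approximation of [h] on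
   [K * K] by functions that are step functions in the second variable. *)
Lemma continuous_fubini :
  Rintegral m K (fun k => Rintegral m K (h k))
  = Rintegral m K (fun l => Rintegral m K (h^~ l)).
Proof.
apply/eqP; rewrite -subr_eq0 -normr_le0; apply/ler_addgt0Pl => e e0; rewrite addr0.
(* By [tube], [V i] is a neighbourhood of [i]; the interiors cover [K], and a finite subcover feeds
   [defect_cover]. The choice [e / 2] makes the total error [e], since [K] has mass one. *)
pose V i := [set l | forall k, K k -> `|h k l - h k i| < e / 2].
pose U i := interior (V i).
have e2 : 0 < e / 2 by rewrite divr_gt0.
have := cK; rewrite compact_cover => /(_ G setT U) [i _||s _ hs].
- exact: open_interior.
- move=> x Kx; exists x => //; rewrite /U /interior.
  exact: (@tube _ (fun l k => h k l) x _ (continuous_uncurry_swap ch) e2).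
have -> : e = 2 * (e / 2) * fine (m K) by rewrite mK1 /= mulr1 mulrC divfK.
apply: (@defect_cover U _ (finmap.enum_fset s)) => //.
- exact: ltW.
- by move=> i; exact: open_interior.
- by move=> i l k /interior_subset Vl Kk; exact/ltW/Vl.
Qed.

End fubini.

End compact_integral.

(** * Continuity and boundedness of complex-valued functions *)

Section complex_valued.
Context {R : realType}.

(** Same body as [ccontinuous], but for any topological domain, so that it also covers parameter
    spaces and products. *)
Definition ccont (T : topologicalType) (h : T -> R[i]) :=
  continuous (fun x => complex.Re (h x)) /\ continuous (fun x => complex.Im (h x)).

Lemma ccont_comp (T U : topologicalType) (a : T -> U) (h : U -> R[i]) :
  continuous a -> ccont h -> ccont (fun t => h (a t)).
Proof.
move=> ca [cr ci]; split=> x.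
- by apply: (@continuous_comp _ _ _ a (fun y => complex.Re (h y))); [exact: ca|exact: cr].
- by apply: (@continuous_comp _ _ _ a (fun y => complex.Im (h y))); [exact: ca|exact: ci].
Qed.

Lemma ReM (a b : R[i]) : complex.Re (a * b) =
  complex.Re a * complex.Re b - complex.Im a * complex.Im b.
Proof. by case: a b => [? ?] [? ?]. Qed.

Lemma ImM (a b : R[i]) : complex.Im (a * b) =
  complex.Re a * complex.Im b + complex.Im a * complex.Re b.
Proof. by case: a b => [? ?] [? ?]. Qed.

Lemma ReD (a b : R[i]) : complex.Re (a + b) = complex.Re a + complex.Re b.
Proof. by case: a b => [? ?] [? ?]. Qed.

Lemma ImD (a b : R[i]) : complex.Im (a + b) = complex.Im a + complex.Im b.
Proof. by case: a b => [? ?] [? ?]. Qed.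

Lemma ccontZ (T : topologicalType) (h : T -> R[i]) (a : R[i]) :
  ccont h -> ccont (fun t => a * h t).
Proof.
move=> [cr ci]; split.
- rewrite (_ : (fun _ => _) = (fun x => complex.Re a * complex.Re (h x)
      - complex.Im a * complex.Im (h x))); last by apply/funext => x; rewrite ReM.
  by move=> x; apply: cvgB; apply: cvgMr; [exact: cr|exact: ci].
- rewrite (_ : (fun _ => _) = (fun x => complex.Re a * complex.Im (h x)
      + complex.Im a * complex.Re (h x))); last by apply/funext => x; rewrite ImM.
  by move=> x; apply: cvgD; apply: cvgMr; [exact: ci|exact: cr].
Qed.

Lemma ccontD (T : topologicalType) (h1 h2 : T -> R[i]) :
  ccont h1 -> ccont h2 -> ccont (fun t => h1 t + h2 t).
Proof.
move=> [cr1 ci1] [cr2 ci2]; split.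
- rewrite (_ : (fun _ => _) = (fun x => complex.Re (h1 x) + complex.Re (h2 x)));
    last by apply/funext => x; rewrite ReD.
  by move=> x; apply: cvgD; [exact: cr1|exact: cr2].
- rewrite (_ : (fun _ => _) = (fun x => complex.Im (h1 x) + complex.Im (h2 x)));
    last by apply/funext => x; rewrite ImD.
  by move=> x; apply: cvgD; [exact: ci1|exact: ci2].
Qed.

Lemma ccont_lin3 (T : topologicalType) (h1 h2 h3 : T -> R[i]) a1 a2 a3 :
  ccont h1 -> ccont h2 -> ccont h3 ->
  ccont (fun t => a1 * h1 t + a2 * h2 t + a3 * h3 t).
Proof.
move=> c1 c2 c3.
exact: (ccontD (ccontD (ccontZ a1 c1) (ccontZ a2 c2)) (ccontZ a3 c3)).
Qed.

Lemma normc_realC (r : R) : `|(r%:C)%C| = (`|r|%:C)%C.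
Proof. by rewrite normc_def /= expr0n addr0 sqrtr_sqr. Qed.

Lemma le_normc_ReIm (z : R[i]) :
  `|z| <= ((`|complex.Re z| + `|complex.Im z|)%:C)%C.
Proof.
rewrite {1}(complexE z); apply: (le_trans (ler_normD _ _)).
rewrite rmorphD /= normrM !normc_realC lerD// -[leRHS]mul1r ler_wpM2r//.
  by rewrite lecR.
by rewrite normc_def /= expr0n expr1n add0r sqrtr1.
Qed.

Lemma Re_le_normc (z : R[i]) (M : R) : `|z| <= (M%:C)%C -> `|complex.Re z| <= M.
Proof. by move=> h; rewrite -lecR; apply: le_trans h; exact: normc_ge_Re. Qed.

Lemma Im_le_normc (z : R[i]) (M : R) : `|z| <= (M%:C)%C -> `|complex.Im z| <= M.
Proof.
rewrite normc_def !lecR; apply: le_trans.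
by rewrite -sqrtr_sqr ler_wsqrtr// lerDr sqr_ge0.
Qed.

Lemma cboundedD (G : Type) (h1 h2 : G -> R[i]) :
  cbounded h1 -> cbounded h2 -> cbounded (fun x => h1 x + h2 x).
Proof.
move=> [M1 b1] [M2 b2]; exists (M1 + M2) => x.
by rewrite rmorphD; apply: (le_trans (ler_normD _ _)); apply: lerD.
Qed.

Lemma cboundedZ (G : Type) (h : G -> R[i]) (a : R[i]) :
  cbounded h -> cbounded (fun x => a * h x).
Proof.
move=> [M b]; exists (complex.Re `|a| * M) => x.
rewrite normrM rmorphM /= (_ : (complex.Re `|a|)%:C%C = `|a|).
  by rewrite ler_wpM2l.
by rewrite normc_def.
Qed.

Lemma cbounded_eq (G : Type) (h1 h2 : G -> R[i]) :
  h1 =1 h2 -> cbounded h1 -> cbounded h2.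
Proof. by move=> /funext ->. Qed.

End complex_valued.

(** * Invariance and linearity of the complex integral over [K] *)

Section haar_integral.
Context {R : realType} {G : ptopologicalType}.
Variables (mul : G -> G -> G) (inv : G -> G) (e : G).
Hypothesis HG : locally_compact_group mul inv e.
Variable K : set G.
Hypothesis HK : compact_subgroup mul inv e K.
Variable m : {measure set (borelG G) -> \bar R}.
Hypothesis Hm : normalized_haar mul K m.

Let mulA x y z : mul x (mul y z) = mul (mul x y) z. Proof. by case: HG => -[]. Qed.
Let mul1 x : mul e x = x. Proof. by case: HG => -[]. Qed.
Let mulx1 x : mul x e = x. Proof. by case: HG => -[]. Qed.
Let mulV x : mul (inv x) x = e. Proof. by case: HG => -[]. Qed.
Let mulxV x : mul x (inv x) = e. Proof. by case: HG => -[]. Qed.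
Let mulK x y : mul (mul x y) (inv y) = x. Proof. by rewrite -mulA mulxV mulx1. Qed.
Let mulVK x y : mul (mul x (inv y)) y = x. Proof. by rewrite -mulA mulV mulx1. Qed.
Let mulI x y z : mul x y = mul x z -> y = z.
Proof. by move=> /(congr1 (mul (inv x))); rewrite !mulA mulV !mul1. Qed.
Let invK x : inv (inv x) = x.
Proof. by apply: (@mulI (inv x)); rewrite mulxV mulV. Qed.
Let invM x y : inv (mul x y) = mul (inv y) (inv x).
Proof. by apply: (@mulI (mul x y)); rewrite mulxV mulA mulK mulxV. Qed.

Let hG : hausdorff_space G. Proof. by case: HG. Qed.
Let cK : compact K. Proof. by case: HK. Qed.
Let mK1 : m K = 1%E. Proof. by case: Hm. Qed.
Let KM x y : K x -> K y -> K (mul x y). Proof. by case: HK => _ + _ _; apply. Qed.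
Let KV x : K x -> K (inv x). Proof. by case: HK => _ _ + _; apply. Qed.
Let KK : K `<=` K := @subset_refl _ K.
Let mK := measurable_compact_borelG hG cK.

Let integrableK (h : G -> R) (ch : continuous h) :
  m.-integrable (K : set (borelG G)) (EFin \o h) :=
  @continuous_integrable _ _ _ hG cK m mK1 K mK KK h ch.

Let cmul (T : topologicalType) (a b : T -> G) :
  continuous a -> continuous b -> continuous (fun t => mul (a t) (b t)).
Proof.
move=> ca cb x; apply: (@continuous_comp _ _ _ (fun t => (a t, b t))
  (fun p : G * G => mul p.1 p.2)); first exact: continuous_pair.
by have [_ cm _ _ _] := HG; exact: cm.
Qed.

Let cinv (T : topologicalType) (a : T -> G) :
  continuous a -> continuous (fun t => inv (a t)).
Proof.
move=> ca x; apply: (@continuous_comp _ _ _ a inv); first exact: ca.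
by have [_ _ ci _ _] := HG; exact: ci.
Qed.

(** Left translation by [k] preserves both [K] and [m], so the change of variables formula for a
    pushforward measure gives the claim. *)
Lemma Rintegral_translate (k : G) (h : G -> R) : K k -> continuous h ->
  Rintegral m K (fun l => h (mul k l)) = Rintegral m K h.
Proof.
move=> Kk ch; congr fine.
have cl : continuous (mul k) by apply: cmul => x; [exact: cvg_cst|exact: cvg_id].
have ml : measurable_fun [set: borelG G] (mul k : borelG G -> borelG G).
  apply: (@measurability _ _ (borelG G) (borelG G) setT (mul k) (@open G)) => // _ [A oA <-].
  rewrite setTI; apply: measurable_open_borelG.
  by move: cl => /continuousP; apply.
have preK : mul k @^-1` K = K.
  apply/seteqP; split=> x /= Kx; last exact: KM.
  by rewrite -[x]mul1 -(mulV k) -mulA; apply: KM => //; exact: KV.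
have pushE A : measurable (A : set (borelG G)) ->
    pushforward m (mul k : borelG G -> borelG G) A = m A.
  move=> mA; rewrite /pushforward; case: Hm => _ _ /(_ (inv k) A (KV Kk) mA) <-.
  congr (m _); apply/seteqP; split=> x /=.
    by move=> Ax; exists (mul k x) => //; rewrite mulA mulV mul1.
  by move=> [y Ay <-]; rewrite mulA mulxV mul1.
have := @integral_pushforward _ _ _ _ R (mul k : borelG G -> borelG G) ml m K
  (EFin \o h).
rewrite preK => <- //.
- by apply: eq_measure_integral => A mA _; exact: pushE.
- apply/measurable_EFinP; apply: continuous_measurable_borelG => //.
- apply: (@integrableK (h \o mul k)) => x.
  by apply: continuous_comp; [exact: cl|exact: ch].
Qed.

Local Notation Kint := (Kint m K).

Lemma Kint_eq (h1 h2 : G -> R[i]) :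
  (forall k, K k -> h1 k = h2 k) -> Kint h1 = Kint h2.
Proof.
move=> h12; rewrite /Defs.Kint; congr Complex; apply: eq_Rintegral => k;
  by rewrite inE => Kk; rewrite h12.
Qed.

Lemma Kint_translate k (h : G -> R[i]) : K k -> ccont h ->
  Kint (fun l => h (mul k l)) = Kint h.
Proof.
move=> Kk [cr ci]; rewrite /Defs.Kint.
rewrite (@Rintegral_translate k (fun l => complex.Re (h l)))//.
by rewrite (@Rintegral_translate k (fun l => complex.Im (h l))).
Qed.

Lemma KintD (h1 h2 : G -> R[i]) : ccont h1 -> ccont h2 ->
  Kint (fun k => h1 k + h2 k) = Kint h1 + Kint h2.
Proof.
move=> [cr1 ci1] [cr2 ci2]; rewrite /Defs.Kint.
under eq_Rintegral do rewrite ReD.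
under [in X in Complex _ X]eq_Rintegral do rewrite ImD.
by rewrite !RintegralD//; exact: integrableK.
Qed.

Lemma KintZ (h : G -> R[i]) a : ccont h -> Kint (fun k => a * h k) = a * Kint h.
Proof.
move=> [cr ci]; rewrite /Defs.Kint.
have cZ (f : G -> R) r : continuous f -> continuous (fun x => r * f x).
  by move=> cf x; apply: cvgMr; exact: cf.
under eq_Rintegral do rewrite ReM.
under [in X in Complex _ X]eq_Rintegral do rewrite ImM.
rewrite RintegralB// ?RintegralD//; try by apply: integrableK; exact: cZ.
rewrite !RintegralZl//; try exact: integrableK.
by case: a.
Qed.

Lemma Kint_lin3 (h1 h2 h3 : G -> R[i]) a1 a2 a3 :
  ccont h1 -> ccont h2 -> ccont h3 ->
  Kint (fun t => a1 * h1 t + a2 * h2 t + a3 * h3 t) =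
  a1 * Kint h1 + a2 * Kint h2 + a3 * Kint h3.
Proof.
move=> c1 c2 c3; have d1 := ccontZ a1 c1; have d2 := ccontZ a2 c2.
by rewrite (KintD (ccontD d1 d2) (ccontZ a3 c3)) (KintD d1 d2) !KintZ.
Qed.

Lemma Kint_const (c : R[i]) : Kint (fun=> c) = c.
Proof.
by rewrite /Defs.Kint !Rintegral_cst// mK1 /= !mulr1; case: c.
Qed.

(** The factor 2 comes from bounding real and imaginary parts separately. It is not sharp, but only
    boundedness matters later. *)
Lemma Kint_le (h : G -> R[i]) (M : R) : ccont h ->
  (forall k, K k -> `|h k| <= (M%:C)%C) -> `|Kint h| <= ((2 * M)%:C)%C.
Proof.
move=> [cr ci] hM; have Ke : K e by case: HK.
have M0 : 0 <= M by rewrite -lecR; exact: le_trans (normr_ge0 _) (hM e Ke).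
apply: (le_trans (le_normc_ReIm _)); rewrite lecR mulr_natl mulr2n /=.
have b (f : G -> R) : continuous f -> (forall k, K k -> `|f k| <= M) ->
    `|Rintegral m K f| <= M.
  move=> cf fM; rewrite -[leRHS]mulr1 -[1](_ : fine (m K) = 1); last by rewrite mK1.
  exact: (@le_Rintegral_bound _ _ _ hG cK m mK1 K mK KK).
apply: lerD.
- by apply: (b (fun k => complex.Re (h k))) => // k /hM; exact: Re_le_normc.
- by apply: (b (fun k => complex.Im (h k))) => // k /hM; exact: Im_le_normc.
Qed.

Lemma Kint_param (T : topologicalType) (h : T -> G -> R[i]) :
  ccont (fun p : T * G => h p.1 p.2) -> ccont (fun t => Kint (h t)).
Proof.
move=> [cr ci]; split => /=.
- exact: (@continuous_Rintegral_param _ _ _ hG cK m mK1 K mK KK T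
    (fun t k => complex.Re (h t k))).
- exact: (@continuous_Rintegral_param _ _ _ hG cK m mK1 K mK KK T
    (fun t k => complex.Im (h t k))).
Qed.

Lemma Kint_fubini (h : G -> G -> R[i]) :
  ccont (fun p : G * G => h p.1 p.2) ->
  Kint (fun k => Kint (h k)) = Kint (fun l => Kint (h^~ l)).
Proof.
move=> [cr ci]; rewrite /Defs.Kint /=; congr Complex.
- exact: (@continuous_fubini _ _ _ hG cK m mK1 (fun t k => complex.Re (h t k))).
- exact: (@continuous_fubini _ _ _ hG cK m mK1 (fun t k => complex.Im (h t k))).
Qed.

(** * Averages over [K]-conjugates and their composition *)

Let ccst (T : topologicalType) (c : G) : continuous (fun _ : T => c).
Proof. by move=> x; exact: cvg_cst. Qed.
Let cid (T : topologicalType) : continuous (fun t : T => t).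
Proof. by move=> x; exact: cvg_id. Qed.
Let cfst (T U V : topologicalType) (a : T -> U * V) :
  continuous a -> continuous (fun t => (a t).1).
Proof. by move=> ca x; apply: (@continuous_comp _ _ _ a fst); [exact: ca|exact: cvg_fst]. Qed.
Let csnd (T U V : topologicalType) (a : T -> U * V) :
  continuous a -> continuous (fun t => (a t).2).
Proof. by move=> ca x; apply: (@continuous_comp _ _ _ a snd); [exact: ca|exact: cvg_snd]. Qed.
Let cfst_comp (T U : topologicalType) (a : T -> G) :
  continuous a -> continuous (fun p : T * U => a p.1).
Proof. by move=> ca x; apply: (@continuous_comp _ _ _ fst a); [exact: cvg_fst|exact: ca]. Qed.

Ltac cont := repeat first [exact: ccst | exact: cid | assumption | apply: cmul |
  apply: cinv | apply: cfst_comp; assumption | apply: cfst | apply: csnd].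

(** The operator [E_x] of the overview: convolution with the image of [m] on the [K]-conjugates of
    [x]. *)
Definition Kavg (x : G) (F : G -> R[i]) (z : G) : R[i] :=
  Kint (fun k => F (mul z (mul k (mul x (inv k))))).

Lemma ccont_Kavg_joint (T : topologicalType) (a b : T -> G) (F : G -> R[i]) :
  continuous a -> continuous b -> ccont F -> ccont (fun t => Kavg (a t) F (b t)).
Proof.
move=> ca cb cF.
apply: (@Kint_param T (fun t k => F (mul (b t) (mul k (mul (a t) (inv k)))))).
by apply: ccont_comp cF; cont.
Qed.

Lemma ccont_Kavg x (F : G -> R[i]) : ccont F -> ccont (Kavg x F).
Proof. by apply: (@ccont_Kavg_joint G (fun=> x) id); cont. Qed.

(** Replacing the inner variable [k] by [l k] turns the product of conjugates into the [l]-conjugate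
    of [x k y k^-1]; Fubini then makes [l] the inner variable. *)
Lemma Kavg_comp_inner x y (F : G -> R[i]) z : ccont F ->
  Kavg x (Kavg y F) z =
  Kint (fun k => Kavg (mul x (mul k (mul y (inv k)))) F z).
Proof.
move=> cF; rewrite /Kavg.
transitivity (Kint (fun l => Kint (fun k =>
    F (mul z (mul l (mul (mul x (mul k (mul y (inv k)))) (inv l))))))).
  apply: Kint_eq => l Kl; rewrite -(@Kint_translate l) //.
    by apply: Kint_eq => k _; congr F; rewrite invM !mulA !mulVK.
  by apply: ccont_comp cF; cont.
rewrite Kint_fubini //.
by apply: (@ccont_comp _ _ _ (fun p : G * G => mul z (mul p.1
  (mul (mul x (mul p.2 (mul y (inv p.2)))) (inv p.1)))) F) => //; cont.
Qed.

(** Mirror image of [Kavg_comp_inner]: here the variable conjugating [x] is translated by the one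
    conjugating [y]. This form is suited to inverses, which reverse products. *)
Lemma Kavg_comp_outer x y (F : G -> R[i]) z : ccont F ->
  Kavg x (Kavg y F) z =
  Kint (fun k => Kavg (mul (mul k (mul x (inv k))) y) F z).
Proof.
move=> cF; rewrite /Kavg.
rewrite (Kint_fubini (h := fun l k => F (mul (mul z (mul l (mul x (inv l))))
  (mul k (mul y (inv k)))))); last first.
  by apply: (@ccont_comp _ _ _ (fun p : G * G => mul (mul z
    (mul p.1 (mul x (inv p.1)))) (mul p.2 (mul y (inv p.2)))) F) => //; cont.
rewrite [RHS](Kint_fubini (h := fun l k => F (mul z (mul k
  (mul (mul (mul l (mul x (inv l))) y) (inv k)))))); last first.
  by apply: (@ccont_comp _ _ _ (fun p : G * G => mul z (mul p.2
    (mul (mul (mul p.1 (mul x (inv p.1))) y) (inv p.2)))) F) => //; cont.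
apply: Kint_eq => k Kk; rewrite -(@Kint_translate k) //.
  by apply: Kint_eq => l _; congr F; rewrite invM !mulA !mulVK.
by apply: ccont_comp cF; cont.
Qed.

Lemma Kavg_lin4 x (F1 F2 F3 F4 : G -> R[i]) a1 a2 a3 a4 z :
  ccont F1 -> ccont F2 -> ccont F3 -> ccont F4 ->
  Kavg x (fun t => a1 * F1 t + a2 * F2 t + a3 * F3 t + a4 * F4 t) z =
  a1 * Kavg x F1 z + a2 * Kavg x F2 z + a3 * Kavg x F3 z + a4 * Kavg x F4 z.
Proof.
move=> c1 c2 c3 c4; rewrite /Kavg.
have cz (F : G -> R[i]) : ccont F ->
    ccont (fun k => F (mul z (mul k (mul x (inv k))))).
  by move=> cF; apply: ccont_comp cF; cont.
have d4 := ccontZ a4 (cz _ c4).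
rewrite (KintD (ccont_lin3 a1 a2 a3 (cz _ c1) (cz _ c2) (cz _ c3)) d4).
by rewrite (Kint_lin3 _ _ _ (cz _ c1) (cz _ c2) (cz _ c3)) (KintZ _ (cz _ c4)).
Qed.

Lemma Kavg_le x (F : G -> R[i]) (M : R) z : ccont F ->
  (forall t, `|F t| <= (M%:C)%C) -> `|Kavg x F z| <= ((2 * M)%:C)%C.
Proof. by move=> cF hM; apply: Kint_le => //; apply: ccont_comp cF; cont. Qed.

(** Averaging preserves boundedness, so [E_x] may be applied to any relation modulo bounded
    functions. Four terms suffice throughout; shorter relations are padded with zero
    coefficients. *)
Lemma cbounded_Kavg4 x (F1 F2 F3 F4 : G -> R[i]) a1 a2 a3 a4 :
  ccont F1 -> ccont F2 -> ccont F3 -> ccont F4 ->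
  cbounded (fun t => a1 * F1 t + a2 * F2 t + a3 * F3 t + a4 * F4 t) ->
  cbounded (fun z => a1 * Kavg x F1 z + a2 * Kavg x F2 z + a3 * Kavg x F3 z
                     + a4 * Kavg x F4 z).
Proof.
move=> c1 c2 c3 c4 b.
apply: (cbounded_eq (fun z => Kavg_lin4 x a1 a2 a3 a4 z c1 c2 c3 c4)).
case: b => M hM; exists (2 * M) => z; apply: Kavg_le => //.
exact: ccontD (ccont_lin3 a1 a2 a3 c1 c2 c3) (ccontZ a4 c4).
Qed.

Lemma dal_lhs_Kavg (mu : G -> R[i]) F x y :
  dal_lhs mul inv m K mu F x y = Kavg y F x + mu y * Kavg (inv y) F x.
Proof. by []. Qed.

Lemma KavgE x (F : G -> R[i]) z :
  Kavg x F z = Kint (fun k => F (mul z (mul k (mul x (inv k))))).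
Proof. by []. Qed.

(* Otherwise [ring] unfolds the integrals when comparing atoms. *)
#[local] Opaque Kavg.

Ltac Kavg_atoms := cbv beta; repeat match goal with
  |- context [Kavg ?a ?b ?d] => generalize (Kavg a b d); intro end.

(** * Relations modulo bounded functions derived from the stability inequality *)

Section stability.
Variables (delta : R) (mu : G -> R[i]).
Hypothesis Hmu : unitary_character mul mu.
Variables f g : G -> R[i].
Hypotheses (cf : ccont f) (cg : ccont g).
Hypothesis Hstab : forall x y : G,
  `|dal_lhs mul inv m K mu f x y - 2 * f x * g y| <= (delta%:C)%C.

Let muM x y : mu (mul x y) = mu x * mu y. Proof. by case: Hmu. Qed.
Let mu_neq0 x : mu x != 0.
Proof. by rewrite -normr_eq0; case: Hmu => _ -> _; exact: oner_neq0. Qed.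
Let mu1 : mu e = 1.
Proof. by apply: (mulfI (mu_neq0 e)); rewrite -muM mul1 mulr1. Qed.
Let muV x : mu x * mu (inv x) = 1. Proof. by rewrite -muM mulxV mu1. Qed.
Let mu_conj k x : mu (mul k (mul x (inv k))) = mu x.
Proof. by rewrite !muM mulrCA muV mulr1. Qed.

Let stabE x y : `|Kavg y f x + mu y * Kavg (inv y) f x - 2 * f x * g y| <= (delta%:C)%C.
Proof. by rewrite -dal_lhs_Kavg. Qed.

(** The stability inequality at the points [x k v k^-1], averaged over [k]. It says that [a + a^*]
    acts on [f] as the scalar [2 * Kavg v g x] for [a = E_x E_v], up to an error uniform in [z]. *)
Let pair_bound x v z :
  `|1 * Kavg x (Kavg v f) z + mu x * mu v * Kavg (inv v) (Kavg (inv x) f) z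
    + - (2 * f z) * Kavg v g x| <= ((2 * delta)%:C)%C.
Proof.
pose w k := mul x (mul k (mul v (inv k))).
have cw : continuous w by cont.
have cwi : continuous (fun k => inv (w k)) by cont.
have c1 : ccont (fun k => Kavg (w k) f z).
  by apply: ccont_Kavg_joint => //; cont.
have c2 : ccont (fun k => Kavg (inv (w k)) f z).
  by apply: ccont_Kavg_joint => //; cont.
have c3 : ccont (fun k => g (w k)) by exact: ccont_comp.
rewrite Kavg_comp_inner// Kavg_comp_outer//.
rewrite (KavgE v g).
(* The inverse of [w k] is the conjugate of [inv v] by [k] times [inv x], the argument produced by
   [Kavg_comp_outer]. *)
rewrite (Kint_eq (h1 := fun k => Kavg (mul (mul k (mul (inv v) (inv k))) (inv x)) f z)
  (h2 := fun k => Kavg (inv (w k)) f z)); last first.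
  by move=> k _; rewrite /w !invM invK !mulA.
rewrite -(Kint_lin3 _ _ _ c1 c2 c3).
apply: Kint_le; first exact: ccont_lin3.
have muw k : mu (w k) = mu x * mu v by rewrite /w muM mu_conj.
by move=> k _; rewrite -(muw k) mul1r mulNr; exact: stabE.
Qed.

Local Notation E := Kavg.
Let cE x F : ccont F -> ccont (E x F) := @ccont_Kavg x F.

Let pair_bounded x v : cbounded (fun z =>
  E x (E v f) z + mu x * mu v * E (inv v) (E (inv x) f) z - 2 * E v g x * f z).
Proof. by exists (2 * delta) => z; have := pair_bound x v z; rewrite mul1r mulNr [2 * _ * _]mulrAC. Qed.

(** The second term is the adjoint of the first, because the factors [mu x] and [mu (inv x)] cancel.
    Up to the factor [mu x], the sum is [a H a^* f]. *)
Let triple_bounded x y : exists c : R[i], cbounded (fun z =>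
  E x (E y (E (inv x) f)) z + mu y * E x (E (inv y) (E (inv x) f)) z - c * f z).
Proof.
(* Average over [l] the relation [pair_bound] for the pair [(x, v l)]. *)
pose v l := mul y (mul l (mul (inv x) (inv l))).
have cv : continuous v by cont.
have cvi : continuous (fun l => inv (v l)) by cont.
exists (2 * Kint (fun l => E (v l) g x)); exists (2 * (2 * delta)) => z.
have c1' : ccont (fun p : G * G => E (v p.1) f (mul z (mul p.2 (mul x (inv p.2))))).
  by apply: ccont_Kavg_joint => //; cont.
have c1 : ccont (fun l => E x (E (v l) f) z) by apply: Kint_param c1'.
have c2 : ccont (fun l => E (inv (v l)) (E (inv x) f) z).
  by apply: ccont_Kavg_joint => //; first [exact: cE | cont].
have c3 : ccont (fun l => E (v l) g x) by apply: ccont_Kavg_joint => //; cont.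
have e1 : E x (E y (E (inv x) f)) z = Kint (fun l => E x (E (v l) f) z).
  under [RHS]Kint_eq do rewrite KavgE.
  rewrite [RHS](Kint_fubini c1') KavgE.
  by apply: Kint_eq => k _; exact: Kavg_comp_inner.
have e2 : E x (E (inv y) (E (inv x) f)) z =
    Kint (fun l => E (inv (v l)) (E (inv x) f) z).
  rewrite Kavg_comp_outer; last exact: cE.
  by apply: Kint_eq => l _; rewrite /v !invM !invK !mulA.
have muv l : mu x * mu (v l) = mu y by rewrite /v muM mu_conj mulrCA muV mulr1.
have -> : E x (E y (E (inv x) f)) z + mu y * E x (E (inv y) (E (inv x) f)) z
    - 2 * Kint (fun l => E (v l) g x) * f z =
  Kint (fun l => 1 * E x (E (v l) f) z + mu y * E (inv (v l)) (E (inv x) f) z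
    + - (2 * f z) * E (v l) g x).
  by rewrite (Kint_lin3 _ _ _ c1 c2 c3) -e1 -e2 mul1r mulNr [2 * _ * f z]mulrAC.
apply: Kint_le; first exact: ccont_lin3.
by move=> l _; rewrite -(muv l); exact: pair_bound.
Qed.

Lemma stable_bounded_eq0 : cbounded f -> ~ cbounded g -> f = (fun=> 0).
Proof.
move=> [M hM] ug; apply/funext => x; apply: contra_notP ug => /eqP fx0.
have b1 : cbounded (fun y => Kavg y f x).
  by exists (2 * M) => y; exact: Kavg_le.
have b2 : cbounded (fun y => mu y * Kavg (inv y) f x).
  exists (2 * M) => y; rewrite normrM; case: Hmu => _ -> _; rewrite mul1r.
  exact: Kavg_le.
have b3 : cbounded (fun y =>
    Kavg y f x + mu y * Kavg (inv y) f x - 2 * f x * g y).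
  by exists delta => y.
(* At a point where [f x] is nonzero, [g] is recovered from bounded functions of [y] by dividing by
   [2 * f x]. *)
apply: cbounded_eq (cboundedZ (2 * f x)^-1
  (cboundedD (cboundedD b1 b2) (cboundedZ (- 1) b3))).
by move=> y; Kavg_atoms; field.
Qed.

Hypothesis f_unbounded : ~ cbounded f.

(** Unboundedness of [f] enters here: coefficients of [f] can be compared modulo bounded
    functions. *)
Let scalar_eq0 (c : R[i]) : cbounded (fun z => c * f z) -> c = 0.
Proof.
move=> b; apply: contra_notP f_unbounded => /eqP c0.
by apply: cbounded_eq (cboundedZ c^-1 b) => z; rewrite mulKf.
Qed.

Let stab_bounded y :
  cbounded (fun t => 1 * E y f t + mu y * E (inv y) f t + (- 2 * g y) * f t + 0 * f t).
Proof.
exists delta => t; rewrite (_ : _ + _ = E y f t + mu y * E (inv y) f t - 2 * f t * g y).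
  exact: stabE.
by ring.
Qed.

Lemma stable_dal_eq : dal_eq mul inv m K mu g g.
Proof.
move=> x y; rewrite dal_lhs_Kavg.
(* The goal is [D = 2 * g x * g y], that is, [c = 0]. *)
set D := _ + _; pose c := 4 * g x * g y - 2 * D.
have cf1 w : ccont (E w f) := cE w cf.
have r3 := cbounded_Kavg4 x (cf1 y) (cf1 (inv y)) cf cf (stab_bounded y).
have r5 := cbounded_Kavg4 y (cf1 x) (cf1 (inv x)) cf cf (stab_bounded x).
have r6 := cbounded_Kavg4 (inv y) (cf1 x) (cf1 (inv x)) cf cf (stab_bounded x).
have p1 := pair_bounded x y.
have p2 : cbounded (fun z => mu y * E x (E (inv y) f) z
    + mu x * E y (E (inv x) f) z - 2 * mu y * E (inv y) g x * f z).
  have := pair_bounded x (inv y); rewrite invK => /(cboundedZ (mu y)).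
  by apply: cbounded_eq => z; rewrite -(mulr1 (mu x * E y _ _)) -(muV y); Kavg_atoms; ring.
(* This is [H E_x f = 2 g y E_x f + c f]. The sum [p1 + p2] gives
   [E_x H f + mu x H E_{x^-1} f = 2 D f]; [r3], [r5] and [r6] with the inequality at [y] eliminate
   all but [H E_x f], [E_x f] and [f]. *)
have r7 : cbounded (fun t => 1 * E y (E x f) t + mu y * E (inv y) (E x f) t
    + (- 2 * g y) * E x f t + (- c) * f t).
  apply: cbounded_eq (cboundedD (cboundedD (cboundedD r5 (cboundedZ (mu y) r6))
    (cboundedD r3 (cboundedZ (2 * g x) (stab_bounded y)))) (cboundedZ (- 1) (cboundedD p1 p2))).
  move=> z; rewrite /c /D. Kavg_atoms. ring.
suff c0 : c = 0.
  have two_neq0 : 2 != 0 :> R[i] by rewrite pnatr_eq0.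
  by apply: (mulfI two_neq0); apply/eqP; rewrite eq_sym -subr_eq0 -c0 /c; apply/eqP; ring.
apply/eqP; apply: contraPT isT => c0.
(* With [c] nonzero, [E_x f] is a multiple of [f] modulo bounded functions. *)
have [lam lamE] : exists lam,
    cbounded (fun t => 1 * E x f t + (- lam) * f t + 0 * f t + 0 * f t).
  have [c1 T] := triple_bounded x y.
  have := pair_bounded x (inv x); rewrite invK muV => q.
  have r9 := cbounded_Kavg4 x (cf1 x) (cf1 (inv x)) cf cf (stab_bounded x).
  have r5x := cbounded_Kavg4 x (cE y (cf1 x)) (cE y (cf1 (inv x))) (cf1 y) (cf1 y) r5.
  have r6x := cbounded_Kavg4 x (cE (inv y) (cf1 x)) (cE (inv y) (cf1 (inv x)))
    (cf1 (inv y)) (cf1 (inv y)) r6.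
  have r7x := cbounded_Kavg4 x (cE y (cf1 x)) (cE (inv y) (cf1 x)) (cf1 x) cf r7.
  (* [H] applied to [E_x^* f = 2 g x f - E_x f], then [E_x]; [r7x] evaluates [E_x H E_x f]. *)
  exists (- ((mu x * c1 - 2 * g y * mu x * E (inv x) g x) / c)).
  apply: cbounded_eq (cboundedZ c^-1 (cboundedD (cboundedD (cboundedD
    (cboundedD r5x (cboundedZ (mu y) r6x)) (cboundedZ (- 1) r7x))
    (cboundedD (cboundedZ (- mu x) T) (cboundedZ (2 * g x) r3)))
    (cboundedD (cboundedZ (- 2 * g y) r9) (cboundedZ (g y * mu x) q)))).
  move=> z. Kavg_atoms. field. exact: c0.
(* Together these give [H E_x f = lam H f = 2 g y lam f = 2 g y E_x f]; comparison with [r7] leaves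
   [c f] bounded. *)
have l1 := cbounded_Kavg4 y (cf1 x) cf cf cf lamE.
have l2 := cbounded_Kavg4 (inv y) (cf1 x) cf cf cf lamE.
suff /scalar_eq0 c1 : cbounded (fun z => c * f z) by rewrite c1 eqxx in c0.
apply: cbounded_eq (cboundedZ (- 1) (cboundedD (cboundedD r7 (cboundedZ (- 1)
  (cboundedD l1 (cboundedZ (mu y) l2)))) (cboundedD (cboundedZ (- lam) (stab_bounded y))
  (cboundedZ (2 * g y) lamE)))).
move=> z. Kavg_atoms. ring.
Qed.

End stability.
End haar_integral.

Theorem theorem5p6 (R : realType) (G : ptopologicalType)
  (mul : G -> G -> G) (inv : G -> G) (e : G)
  (HG : locally_compact_group mul inv e)
  (K : set G) (HK : compact_subgroup mul inv e K)
  (m : {measure set (borelG G) -> \bar R}) (Hm : normalized_haar mul K m)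
  (delta : R) (Hdelta : 0 < delta)
  (mu : G -> R[i]) (Hmu : unitary_character mul mu)
  (f g : G -> R[i]) (Hf : ccontinuous f) (Hg : ccontinuous g)
  (HfK : K_central mul K f)
  (Hstab : forall x y : G,
     `|dal_lhs mul inv m K mu f x y - 2 * f x * g y| <= (delta%:C)%C) :
  (cbounded f /\ cbounded g)
  \/ (~ cbounded f /\ dal_eq mul inv m K mu g g)
  \/ (~ cbounded g /\ dal_eq mul inv m K mu f g
      /\ (f <> (fun _ => 0) -> CK mul inv m K f <> (fun _ => 0) ->
          dal_eq mul inv m K mu g g)).
Proof.
have [bf|uf] := pselect (cbounded f); last first.
  right; left; split=> //.
  exact: (stable_dal_eq HG HK Hm Hmu Hf Hg Hstab uf).
have [bg|ug] := pselect (cbounded g); first by left.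
have f0 := stable_bounded_eq0 HG HK Hm Hmu Hf Hstab bf ug.
(* Since [f] is zero, both sides of the equation vanish and the premise [f <> 0] of the last clause
   is contradictory. *)
right; right; split=> //; split=> [x y|]; last by rewrite f0.
by rewrite /dal_lhs f0 !(Kint_const HG HK Hm) !mulr0 mul0r addr0.
Qed.
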